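(* Let $n$ be a positive integer. There exists a function $\gamma: S_n \to \mathcal{T}_n^2$ such that $c = s\circ \gamma$; that is, $c(\phi)=s(\gamma(\phi))$ for every $\phi\in S_n$.
   Context: $Z_n=\{0,1,\dots,n-1\}$, and $S_n$ is the set of permutations of $Z_n$. For a positive integer $k$, a $k$-tournament on $Z_n$ is a complete digraph with vertex set $Z_n$ and a weight function $\omega_T$ assigning to each ordered pair of distinct vertices $(x,y)$ a nonnegative integer, such that $\omega_T(x,y)+\omega_T(y,x)=k$ for all distinct $x,y\in Z_n$. $\mathcal{T}_n^k$ is the set of $k$-tournaments on $Z_n$. The score of a vertex $i$ is $s_T(i)=\sum_{j\neq i}\omega_T(i,j)$, and the score sequence $s(T)$ is the nondecreasing sequence formed from the multiset $\{s_T(i): i\in Z_n\}$. For $\phi\in S_n$, the characteristic sequence $c(\phi)$ is the nondecreasing sequence formed from the multiset $C(\phi)=\{i+\phi(i): i\in Z_n\}$. *)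

(* Defs.v *)
From mathcomp Require Import all_boot all_fingroup.

Set Implicit Arguments.
Unset Strict Implicit.
Unset Printing Implicit Defensive.

(* The weight is only meaningful on ordered pairs of distinct vertices; its
   diagonal is normalised to 0 so that a k-tournament is determined by its
   off-diagonal weights. *)
Record ktournament (n k : nat) := KTournament {
  weight : {ffun 'I_n * 'I_n -> nat};
  weight_diag : forall x, weight (x, x) = 0;
  weight_sum : forall x y, x != y -> weight (x, y) + weight (y, x) = k
}.

Definition score n k (T : ktournament n k) (i : 'I_n) : nat :=
  \sum_(j < n | j != i) weight T (i, j).

Definition score_seq n k (T : ktournament n k) : seq nat :=
  sort leq [seq score T i | i : 'I_n <- enum 'I_n].

(* The sum i + phi i is taken in nat, not modulo n. *)
Definition char_seq n (phi : 'S_n) : seq nat :=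
  sort leq [seq i + phi i | i : 'I_n <- enum 'I_n].

(* Main.v *)
Require Import Defs.
From mathcomp Require Import all_boot all_fingroup.

(** The transitive tournament in which [i] beats exactly the smaller vertices
    has scores [i]; relabelled by [phi], it has scores [phi i]. Superposing the
    two gives a 2-tournament in which vertex [i] has score [i + phi i]. *)

Definition superposed_weight n (phi : 'S_n) : {ffun 'I_n * 'I_n -> nat} :=
  [ffun p : 'I_n * 'I_n => (p.2 < p.1) + (phi p.2 < phi p.1)].

Lemma superposed_weight_diag n (phi : 'S_n) x : superposed_weight n phi (x, x) = 0.
Proof. by rewrite ffunE /= !ltnn. Qed.

Lemma addn_ltn_ord n (x y : 'I_n) : x != y -> (y < x) + (x < y) = 1.
Proof. by rewrite -val_eqE /=; case: ltngtP. Qed.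

Lemma superposed_weight_sum n (phi : 'S_n) x y :
  x != y -> superposed_weight n phi (x, y) + superposed_weight n phi (y, x) = 2.
Proof.
(* [addnACA] pairs the indicators by tournament; each pair sums to 1, the second since [phi] keeps
   [x] and [y] distinct. *)
move=> xNy; rewrite !ffunE /= addnACA !addn_ltn_ord //.
by rewrite (inj_eq perm_inj).
Qed.

Definition superposed_tournament n (phi : 'S_n) : ktournament n 2 :=
  KTournament (superposed_weight_diag n phi) (superposed_weight_sum n phi).

Lemma sum_ltn_ord n (i : 'I_n) : \sum_(j < n) (j < i) = i.
Proof.
(* Write [i] as a sum of ones over ['I_i], then widen the range to ['I_n] under the condition
   [j < i]. *)
rewrite -[RHS]card_ord -sum1_card (big_ord_widen n (fun=> 1)) 1?ltnW //.
by rewrite [RHS]big_mkcond; apply: eq_bigr => j _; case: (j < i).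
Qed.

Lemma score_superposed n (phi : 'S_n) i :
  score (superposed_tournament n phi) i = i + phi i.
Proof.
transitivity (\sum_(j < n) ((j < i) + (phi j < phi i))).
  (* The term [j = i], absent from the score, is 0 because both comparisons are strict. *)
  rewrite [RHS](bigD1 i) //= !ltnn.
  by apply: eq_bigr => j _; rewrite ffunE.
rewrite big_split /= sum_ltn_ord; congr (_ + _).
(* As [j] runs over ['I_n], so does [phi j]: this is the same count, taken at [phi i]. *)
by rewrite -[RHS]sum_ltn_ord [RHS](reindex_inj (@perm_inj _ phi)).
Qed.

Theorem theorem1p4 (n : nat) (hn : 0 < n) :
  exists gamma : 'S_n -> ktournament n 2,
    forall phi : 'S_n, char_seq phi = score_seq (gamma phi).
Proof.
exists (superposed_tournament n) => phi; congr (sort leq _).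
by apply: eq_map => i; rewrite score_superposed.
Qed.
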